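(* For every integer $n\geqslant 4$, $\mathrm{IEnd}(S_n)=\langle a_0,b_0,e_1,c,d,z_1\rangle$ (the monoid $\mathrm{IEnd}(S_n)$ is generated by these six elements), and $\mathrm{IEnd}(S_n)$ has rank $6$.
   Context: For $n\geqslant1$, the star graph $S_n$ is the simple graph with vertex set $\{0,1,\ldots,n-1\}$ and edge set $E=\{\{0,i\}\mid 1\leqslant i\leqslant n-1\}$ (so $n$ vertices). $\mathcal{PT}(V)$ denotes the monoid of all partial transformations (partial maps $V\to V$, including the empty one) of a finite set $V$ under composition; maps are written on the right and composed left to right. For a graph $G=(V,E)$, a map $\alpha\in\mathcal{PT}(V)$ is a partial endomorphism of $G$ if for all $u,v\in\mathrm{Dom}(\alpha)$: $\{u,v\}\in E$ implies $\{u\alpha,v\alpha\}\in E$. $\mathrm{IEnd}(G)$ is the set of all injective partial endomorphisms of $G$; it is a submonoid of $\mathcal{PT}(V)$. The rank of a finite monoid $M$ is the minimum size of a generating set of $M$ (as a monoid). The following elements are used (in two-row notation the top row lists the domain and the bottom row the images): $a_0=\begin{pmatrix}0&1&2&3&\cdots&n-1\\0&2&1&3&\cdots&n-1\end{pmatrix}$, $b_0=\begin{pmatrix}0&1&2&\cdots&n-2&n-1\\0&2&3&\cdots&n-1&1\end{pmatrix}$, $e_1=\begin{pmatrix}0&1&\cdots&n-2\\0&1&\cdots&n-2\end{pmatrix}$, $c=\begin{pmatrix}1&2&\cdots&n-1\\0&2&\cdots&n-1\end{pmatrix}$ (domain $\{1,\ldots,n-1\}$, $1\mapsto0$, $i\mapsto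 i$ for $i\geqslant2$), $d=\begin{pmatrix}1&2&\cdots&n-1\\1&2&\cdots&n-1\end{pmatrix}$, $z_1=\begin{pmatrix}0&1\\1&0\end{pmatrix}$ (domain $\{0,1\}$). *)

(* Defs.v *)
From HB Require Import structures.
From mathcomp Require Import all_boot.

Set Implicit Arguments.
Unset Strict Implicit.
Unset Printing Implicit Defensive.

#[short(type="finMonoidType")]
HB.structure Definition FinMonoid := {M of Monoid M & Finite M}.

Section Generation.

Local Open Scope group_scope.

Variable T : finMonoidType.
Implicit Types A M : {set T}.

Definition monoid_set M : bool :=
  (1 \in M) && [forall x in M, forall y in M, x * y \in M].

Lemma monoid_setP M : reflect (monoid_closed M) (monoid_set M).
Proof.
apply: (iffP andP) => -[M1 Mm]; split=> //.
  by move=> x y Mx My; have /forall_inP/(_ _ Mx)/forall_inP/(_ _ My) := Mm.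
by apply/forall_inP => x Mx; apply/forall_inP => y My; apply: Mm.
Qed.

Definition mgen A : {set T} :=
  \bigcap_(M : {set T} | monoid_set M && (A \subset M)) M.

Lemma mgen_id M : monoid_set M -> mgen M = M.
Proof.
move=> Mm; apply/eqP; rewrite eqEsubset; apply/andP; split.
  by apply: (bigcap_inf M); rewrite Mm /=.
by apply/bigcapsP => N /andP[].
Qed.

(* The minimum size of a generating set of the submonoid M; the default M of
   the arg min generates M, so it satisfies the constraint (see [mrankP]), and
   a set A with mgen A = M is automatically included in M. *)
Definition mrank M : nat := #|[arg min_(A < M | mgen A == M) #|A| ]|.

Lemma mrankP M : monoid_set M ->
  (exists2 A, mgen A = M & #|A| = mrank M) /\
  (forall A, mgen A = M -> mrank M <= #|A|).
Proof.
move=> /mgen_id/eqP MM; rewrite /mrank.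
case: arg_minnP => // A /eqP genA minA; split; first by exists A.
by move=> B /eqP; apply: minA.
Qed.

End Generation.

Definition ptrans (V : finType) : Type := {ffun V -> option V}.

HB.instance Definition _ (V : finType) := Finite.on (ptrans V).

Section PartialTransformations.

Variable V : finType.
Implicit Types (f g : ptrans V) (e : rel V).

Definition pt_id : ptrans V := [ffun v => Some v].

(* Left to right composition: first f, then g. *)
Definition pt_mul f g : ptrans V := [ffun v => obind g (f v)].

Lemma pt_mulA : associative pt_mul.
Proof.
move=> f g h; apply/ffunP => v; rewrite !ffunE.
by case: (f v) => //= w; rewrite ffunE.
Qed.

Lemma pt_mul1 : left_id pt_id pt_mul.
Proof. by move=> f; apply/ffunP => v; rewrite !ffunE. Qed.

Lemma pt_mulr1 : right_id pt_id pt_mul.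
Proof.
by move=> f; apply/ffunP => v; rewrite !ffunE; case: (f v) => //= w; rewrite ffunE.
Qed.

HB.instance Definition _ := isMonoid.Build (ptrans V) pt_mulA pt_mul1 pt_mulr1.

Definition pt_dom f : {set V} := [set v | f v != None].

(* A simple graph on V is given by its (symmetric, irreflexive) adjacency
   relation e. *)
Definition partial_endo e f : bool :=
  [forall u in pt_dom f, forall v in pt_dom f,
     e u v ==> (if (f u, f v) is (Some u', Some v') then e u' v' else false)].

Definition IEnd e : {set ptrans V} :=
  [set f : ptrans V | dinjectiveb f (pt_dom f) && partial_endo e f].

Lemma in_IEndP e f :
  reflect ((forall u v w, f u = Some w -> f v = Some w -> u = v) /\
           (forall u v u' v',
              f u = Some u' -> f v = Some v' -> e u v -> e u' v'))
          (f \in IEnd e).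
Proof.
rewrite inE; apply: (iffP andP) => -[].
  move=> /dinjectiveP fI /forall_inP fE; split.
    by move=> u v w fu fv; apply: fI; rewrite ?inE ?fu ?fv.
  move=> u v u' v' fu fv euv.
  have /fE/forall_inP/(_ v) : u \in pt_dom f by rewrite inE fu.
  by rewrite inE fu fv euv; apply.
move=> fI fE; split.
  apply/dinjectiveP => u v; rewrite !inE.
  by case fu: (f u) => [w|//] _ _ /esym; apply: fI fu.
apply/forall_inP => u; rewrite inE; case fu: (f u) => [u'|//] _.
apply/forall_inP => v; rewrite inE; case fv: (f v) => [v'|//] _.
by apply/implyP; apply: fE.
Qed.

Lemma IEnd_monoid e : monoid_set (IEnd e).
Proof.
apply/monoid_setP; split.
  apply/in_IEndP; split=> [u v w | u v u' v']; rewrite !ffunE.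
    by case=> -> [->].
  by case=> <- [<-].
move=> f g /in_IEndP[fI fE] /in_IEndP[gI gE]; apply/in_IEndP; split.
  move=> u v w; rewrite !ffunE.
  case fu: (f u) => [u'|//]; case fv: (f v) => [v'|//] /= gu gv.
  by apply: fI fu _; rewrite fv (gI _ _ _ gu gv).
move=> u v u' v'; rewrite !ffunE.
case fu: (f u) => [u1|//]; case fv: (f v) => [v1|//] /= gu gv euv.
exact: gE gu gv (fE _ _ _ _ fu fv euv).
Qed.

End PartialTransformations.

Section Star.

Variable n : nat.

Definition star : rel 'I_n :=
  [rel u v : 'I_n | (u == 0 :> nat) && (0 < v) || (v == 0 :> nat) && (0 < u)].

Lemma star_sym : symmetric star.
Proof. by move=> u v; rewrite /star /= orbC. Qed.

Lemma star_irr : irreflexive star.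
Proof. by move=> u; rewrite /star /= orbb; case: (nat_of_ord u). Qed.

(* The partial map i |-> f i with domain D; a point of D whose image is not
   below n is dropped from the domain, which does not happen for the maps
   below when n >= 3. *)
Definition pt_of (D : pred nat) (f : nat -> nat) : ptrans 'I_n :=
  [ffun i : 'I_n => if D i then insub (f i) else None].

Definition a0 := pt_of predT [fun i : nat => i with 1 |-> 2, 2 |-> 1].
Definition b0 := pt_of predT [fun i : nat => i.+1 with 0 |-> 0, n.-1 |-> 1].
Definition e1 := pt_of (fun i => i <= n - 2) id.
Definition c := pt_of (fun i => 1 <= i) [fun i : nat => i with 1 |-> 0].
Definition d := pt_of (fun i => 1 <= i) id.
Definition z1 := pt_of (fun i => i <= 1) [fun i : nat => i with 0 |-> 1, 1 |-> 0].

End Star.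

(* Main.v *)
(* Generation: transpositions of leaves come from a0 by conjugating with powers
   of b0, so all permutations fixing the centre 0 are generated; with e1 one gets
   every partial injection fixing 0, by induction on the number of undefined
   points.  Any other member of IEnd(S_n) factors through d (0 outside the domain
   and the image), through c (0 outside the domain, inside the image), or through
   z1 (0 is moved, which leaves room for at most one leaf in the domain).

   Rank: if no generator lies in a suitable class, then some proper submonoid
   contains all the generators.  This forces, in every generating set, two
   distinct units (the unit group is not commutative), a non-unit fixing 0, an
   element moving 0, and two elements undefined at 0, one with 0 in its image and
   one without.  These classes are pairwise disjoint, hence at least six
   generators. *)
Require Import Defs.
From mathcomp Require Import all_boot.
From mathcomp Require Import fingroup perm zify.

Set Implicit Arguments.
Unset Strict Implicit.
Unset Printing Implicit Defensive.

Local Open Scope group_scope.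

(** * Generated submonoids and the escape principle *)

Section Generation.

Variable T : finMonoidType.
Implicit Types A M : {set T}.

Lemma sub_mgen A : A \subset mgen A.
Proof. by apply/bigcapsP => M /andP[]. Qed.

Lemma mgen_min A M : monoid_closed M -> A \subset M -> mgen A \subset M.
Proof.
by move=> /monoid_setP Mm sAM; apply: (bigcap_inf M); rewrite ?Mm ?sAM.
Qed.

Lemma mgen_monoid A : monoid_closed (mgen A).
Proof.
split=> [|x y /bigcapP xA /bigcapP yA]; apply/bigcapP => M /andP[/[dup] Mm].
  by case/monoid_setP.
by case/monoid_setP=> _ MM sAM; apply: MM; [apply: xA|apply: yA]; rewrite Mm.
Qed.

(** The elements of [mgen A] satisfying [P] form a submonoid; if it contained [A] it would contain
    [x]. Closure is asked only inside [mgen A], so that invariants may rely on membership there. *)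
Lemma mgen_escape (P : pred T) A x :
    x \in mgen A -> ~~ P x -> P 1 ->
    {in mgen A &, forall u v, P u -> P v -> P (u * v)} ->
  exists2 a, a \in A & ~~ P a.
Proof.
move=> xA nPx P1 PM; have [A1 AM] := mgen_monoid A.
apply/exists_inP; apply: contraNT nPx; rewrite negb_exists_in => /forall_inP PA.
suff /subsetP/(_ _ xA): mgen A \subset [set y in mgen A | P y].
  by rewrite inE => /andP[].
apply: mgen_min => [|].
  split=> [|u v]; rewrite !inE ?A1 //.
  by move=> /andP[uA Pu] /andP[vA Pv]; rewrite AM //= PM.
apply/subsetP => a aA; rewrite inE (subsetP (sub_mgen A)) //=.
by have := PA a aA; rewrite negbK.
Qed.

End Generation.

(** * Partial injections and permutations of a finite set *)

Section PartialInjections.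

Variable V : finType.
Implicit Types (f g : ptrans V) (s t : {perm V}).

Definition pt_inj f : Prop := forall u v w, f u = Some w -> f v = Some w -> u = v.

Definition pt_perm s : ptrans V := [ffun v => Some (s v)].

Lemma pt_mulE f g v : (f * g : ptrans V) v = obind g (f v).
Proof. by rewrite ffunE. Qed.

Lemma pt_permM s t : pt_perm (s * t) = pt_perm s * pt_perm t.
Proof. by apply/ffunP => v; rewrite pt_mulE !ffunE /= ffunE permM. Qed.

Lemma pt_perm1 : pt_perm 1 = 1.
Proof. by apply/ffunP => v; rewrite !ffunE perm1. Qed.

Lemma pt_inj_total f : pt_inj f -> (forall v, f v) -> exists s, f = pt_perm s.
Proof.
move=> fI fT; pose h v := odflt v (f v).
have fE v : f v = Some (h v) by rewrite /h; case: (f v) (fT v).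
have hI : injective h by move=> u v huv; apply: fI (fE u) _; rewrite huv.
by exists (perm hI); apply/ffunP => v; rewrite ffunE permE.
Qed.

(** Pigeonhole: a map onto all [Some j] that also takes the value [None] would cover [option V] from
    [V]. *)
Lemma pt_not_onto f i : f i = None -> exists j, forall v, f v <> Some j.
Proof.
move=> fi; suff /existsP[j /forallP nj]: [exists j, forall v, f v != Some j].
  by exists j => v; apply/eqP.
apply: contraT; rewrite negb_exists => /forallP fV.
suff: #|{: option V}| <= #|V| by rewrite card_option ltnn.
apply: leq_trans (leq_image_card f V); apply: subset_leq_card.
apply/subsetP => -[j|] _; last by apply/codomP; exists i.
have := fV j; rewrite negb_forall => /existsP[v]; rewrite negbK => /eqP fv.
by apply/codomP; exists v.
Qed.

End PartialInjections.

(** * The six elements as explicit maps on a star with leaves 1, 2, 3 at least *)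

Section Star.

Variable m : nat.
Local Notation n := m.+4.
Implicit Types (f g x y : ptrans 'I_n) (s t : {perm 'I_n}).

Local Notation o1 := (Ordinal (isT : 1 < n)).
Local Notation o2 := (Ordinal (isT : 2 < n)).
Local Notation o3 := (Ordinal (isT : 3 < n)).
Local Notation I := (IEnd (@star n)).

Lemma starE (u v : 'I_n) : star u v = ((u == ord0) != (v == ord0)).
Proof. by rewrite /star -!val_eqE /=; lia. Qed.

Lemma pt_ofP D h (i w : 'I_n) :
  (pt_of n D h i = Some w) <-> (D i /\ h i = w :> nat).
Proof.
rewrite ffunE; case: (D i); last by split=> // -[].
case: insubP => [u _ uh|/negP hn]; last first.
  by split=> // -[_ hw]; case: hn; rewrite hw ltn_ord.
split=> [[<-] //|[_ hw]].
by congr Some; apply: val_inj; rewrite uh.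
Qed.

Lemma pt_of_None (D : pred nat) h (i : 'I_n) : ~~ D i -> pt_of n D h i = None.
Proof. by rewrite ffunE => /negPf->. Qed.

Lemma a0_perm : a0 n = pt_perm (tperm o1 o2).
Proof.
apply/ffunP => v; rewrite [RHS]ffunE; apply/pt_ofP; split=> //=.
by rewrite permE /= -!val_eqE /=; case: ifP => // _; case: ifP.
Qed.

Lemma b0_perm :
  exists2 s, b0 n = pt_perm s &
    forall u w : 'I_n, 0 < u -> w = u.+1 :> nat -> s u = w.
Proof.
have bS (u w : 'I_n) : 0 < u -> w = u.+1 :> nat -> b0 n u = Some w.
  move=> u0 wu; apply/pt_ofP; split=> //=.
  by have := ltn_ord w; do 2?case: ifP; lia.
have [s sE] : exists s, b0 n = pt_perm s.
  rewrite /b0; apply: pt_inj_total => [u v w /pt_ofP[_ /= uw] /pt_ofP[_ /= vw]|u].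
    by apply: val_inj; move: uw vw (ltn_ord u) (ltn_ord v) => /=;
       do 4?case: ifP; lia.
  (* The conditional unfolds the formula of [b0], so that its value at [u] can be packaged as an
     ordinal. *)
  have lt :
      (if u == 0 :> nat then 0 else if u == m.+3 :> nat then 1 else u.+1)%N < n.
    by have := ltn_ord u; do 2?case: ifP; lia.
  by rewrite (iffRL (pt_ofP _ _ _ (Ordinal lt))).
exists s => // u w u0 wu; have := bS u w u0 wu.
by rewrite sE ffunE => -[].
Qed.

Lemma e1E v : e1 n v = if v == ord_max then None else Some v.
Proof.
have [->|vm] := eqVneq v ord_max; first by apply: pt_of_None; rewrite /=; lia.
by apply/pt_ofP; split=> //; move: vm (ltn_ord v); rewrite -val_eqE /=; lia.
Qed.

Lemma cE v : c n v = if v == ord0 then None else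
                     if v == o1 then Some ord0 else Some v.
Proof.
have [->|v0] := eqVneq v ord0; first exact: pt_of_None.
have [->|v1] := eqVneq v o1; first exact/pt_ofP.
apply/pt_ofP; rewrite lt0n; split=> //=.
by move: v1; rewrite -val_eqE /= => /negPf->.
Qed.

Lemma dE v : d n v = if v == ord0 then None else Some v.
Proof.
have [->|v0] := eqVneq v ord0; first exact: pt_of_None.
by apply/pt_ofP; rewrite lt0n.
Qed.

Lemma z1E v : z1 n v = if v == ord0 then Some o1 else
                       if v == o1 then Some ord0 else None.
Proof.
have [->|v0] := eqVneq v ord0; first exact/pt_ofP.
have [->|v1] := eqVneq v o1; first exact/pt_ofP.
by apply: pt_of_None; move: v0 v1; rewrite -!val_eqE /=; lia.
Qed.

(** * What a submonoid containing the six elements must contain *)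

Section Generate.

Variable N : {set ptrans 'I_n}.
Hypothesis Nm : monoid_closed N.
Hypothesis gensN : [set a0 n; b0 n; e1 n; c n; d n; z1 n] \subset N.

Lemma mulN f g : f \in N -> g \in N -> f * g \in N.
Proof. by case: Nm => _; apply. Qed.

(** Finiteness turns closure under products into a group, which makes conjugation available. *)
Lemma perm_group_set : group_set [set s | pt_perm s \in N].
Proof.
apply/group_setP; split=> [|s t]; rewrite !inE ?pt_perm1 ?pt_permM.
  by case: Nm.
exact: mulN.
Qed.
Local Notation G := (group perm_group_set).

Lemma genN f : f \in [set a0 n; b0 n; e1 n; c n; d n; z1 n] -> f \in N.
Proof. exact: (subsetP gensN). Qed.

(** Conjugating by [b0] shifts a transposition of adjacent leaves one step up, starting from
    [a0]. *)
Lemma tperm_adj k (u w : 'I_n) :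
  u = k.+1 :> nat -> w = k.+2 :> nat -> tperm u w \in G.
Proof.
have [b bE bS] := b0_perm.
have bG : b \in G by rewrite inE -bE genN // !inE eqxx ?orbT.
elim: k u w => [|k IH] u w uk wk.
  have [-> ->] : u = o1 /\ w = o2 by split; apply: val_inj.
  by rewrite inE -a0_perm genN // !inE eqxx.
have lt1 : k.+1 < n by have := ltn_ord u; lia.
have lt2 : k.+2 < n by have := ltn_ord u; lia.
have <- : tperm (Ordinal lt1) (Ordinal lt2) ^ b = tperm u w.
  by rewrite tpermJ (bS _ u) // (bS _ w).
by rewrite groupJ // IH.
Qed.

(** Conjugating by adjacent transpositions yields every [tperm o1 v]; these in turn conjugate to
    [tperm u w]. *)
Lemma tperm_leaf (u w : 'I_n) : u != ord0 -> w != ord0 -> tperm u w \in G.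
Proof.
have t1 k (v : 'I_n) : v = k.+1 :> nat -> tperm o1 v \in G.
  elim: k v => [|k IH] v vk; first by rewrite (_ : v = o1) ?tperm1 //; apply: val_inj.
  have lt1 : k.+1 < n by have := ltn_ord v; lia.
  have [k0|k0] := posnP k.
    by apply: (@tperm_adj 0) => //=; lia.
  have <- : tperm o1 (Ordinal lt1) ^ tperm (Ordinal lt1) v = tperm o1 v.
    by rewrite tpermJ tpermL tpermD // -val_eqE /=; lia.
  by rewrite groupJ ?IH // (@tperm_adj k).
have t1' v : v != ord0 -> tperm o1 v \in G.
  by rewrite -val_eqE /= => v0; apply: (t1 v.-1); lia.
move=> u0 w0; have [<-|u1] := eqVneq o1 u; first exact: t1'.
have [<-|w1] := eqVneq o1 w; first by rewrite tpermC t1'.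
have [->|uw] := eqVneq u w; first by rewrite tperm1.
by rewrite -(tpermJ_tperm w1 uw) groupJ ?t1'.
Qed.

(** Induction on the number of moved points: multiplying by [tperm v (s v)] makes [v] fixed and
    moves no point that was fixed. *)
Lemma perm_leaf s : s ord0 = ord0 -> pt_perm s \in N.
Proof.
move=> s0; suff: s \in G by rewrite inE.
have [k] := ubnP #|[pred v | s v != v]|; elim: k s s0 => // k IH s s0 lek.
have [v sv|s1] := pickP [pred v | s v != v]; last first.
  suff -> : s = 1 by [].
  by apply/permP => v; rewrite perm1; apply/eqP/negbFE; apply: s1.
have v0 : v != ord0 by apply: contraNneq sv => /= ->; rewrite s0.
have sv0 : s v != ord0 by rewrite -s0 (inj_eq perm_inj).
have tG : tperm v (s v) \in G by apply: tperm_leaf.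
rewrite -(groupMr _ tG); apply: IH; first by rewrite permM s0 tpermD.
apply: leq_trans (ltnSE lek); apply: proper_card.
apply/properP; split; last by exists v; rewrite !inE ?permM ?tpermR ?eqxx.
apply/subsetP => u; rewrite !inE permM; apply: contraNneq => su.
have uv : v != u by apply: contraNneq sv => /= ->; rewrite su.
by rewrite su tpermD // -su (inj_eq perm_inj).
Qed.

Lemma restr_leaf (i : 'I_n) :
  i != ord0 -> [ffun v => if v == i then None else Some v] \in N.
Proof.
move=> i0; set t := tperm i ord_max.
have tN : pt_perm t \in N by apply: perm_leaf; rewrite tpermD // eq_sym.
have eN : e1 n \in N by apply: genN; rewrite !inE eqxx ?orbT.
suff <- : pt_perm t * e1 n * pt_perm t =
           [ffun v => if v == i then None else Some v].
  by rewrite !mulN.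
apply/ffunP => v; rewrite !pt_mulE !ffunE /= e1E.
(* With [ord_max] written as [t i], the domain test [t v == ord_max] becomes [v == i]. *)
rewrite -{1}(tpermL i ord_max) (inj_eq perm_inj).
by case: eqP => //= _; rewrite ffunE tpermK.
Qed.

(** A map undefined at [i] is the identity off [i] followed by an extension [g] with one more point
    in its domain: [g] sends [i] to a value that [f] misses. *)
Lemma pt_inj_fix0 f : pt_inj f -> f ord0 = Some ord0 -> f \in N.
Proof.
have [k] := ubnP #|[pred v | f v == None]|; elim: k f => // k IH f lek fI f0.
have [i /eqP fi|fT] := pickP [pred v | f v == None]; last first.
  have [|s sE] := pt_inj_total fI; first by move=> v; have /= := fT v; case: (f v).
  by rewrite sE perm_leaf //; move: f0; rewrite sE ffunE => -[].
have i0 : i != ord0 by apply: contraPneq fi => ->; rewrite f0.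
have [j nj] := pt_not_onto fi.
pose g : ptrans 'I_n := [ffun v => if v == i then Some j else f v].
have -> : f = ([ffun v => if v == i then None else Some v] : ptrans 'I_n) * g.
  apply/ffunP => v; rewrite pt_mulE ffunE.
  by case: eqP => [->|/eqP/negPf vi] //=; rewrite ffunE vi.
apply: mulN; first exact: restr_leaf.
apply: IH => [|u v w|]; last by rewrite ffunE eq_sym (negPf i0).
- apply: leq_trans (ltnSE lek); apply: proper_card.
  apply/properP; split; last by exists i; rewrite !inE ?fi // ffunE eqxx.
  by apply/subsetP => u; rewrite !inE ffunE; case: (u == i).
rewrite !ffunE; case: eqP => [->|_]; case: eqP => [->|_] //.
- by case=> <- /nj.
- by move=> fu [jw]; case: (nj u); rewrite jw.
exact: fI.
Qed.

Lemma IEnd_sub_gen : I \subset N.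
Proof.
apply/subsetP => f /in_IEndP[fI fE].
case f0: (f ord0) => [j|]; last first.
  have [i /eqP fi|f'0] := pickP [pred i | f i == Some ord0]; last first.
    (* [d] erases 0, so the value of [g] there is free; 0 keeps [g] injective because [f] misses
       0. *)
    pose g : ptrans 'I_n := [ffun v => if v == ord0 then Some ord0 else f v].
    have -> : f = d n * g.
      apply/ffunP => v; rewrite pt_mulE dE.
      by case: eqP => [->|/eqP/negPf vi] //=; rewrite ffunE vi.
    apply: mulN; first by apply: genN; rewrite !inE eqxx ?orbT.
    apply: pt_inj_fix0; last by rewrite ffunE.
    move=> u v w; rewrite !ffunE; case: eqP => [->|_]; case: eqP => [->|_] //.
    + by case=> <- fv; have /= := f'0 v; rewrite fv eqxx.
    + by move=> fu [w0]; have /= := f'0 u; rewrite fu w0 eqxx.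
    exact: fI.
  have i0 : i != ord0 by apply: contraPneq fi => ->; rewrite f0.
  pose t := tperm o1 i.
  have t0 : t ord0 = ord0 by rewrite tpermD.
  have tE0 v : (t v == ord0) = (v == ord0) by rewrite -{1}t0 (inj_eq perm_inj).
  have tE1 v : (t v == o1) = (v == i).
    by rewrite -(tpermR o1 i) (inj_eq perm_inj).
  (* After [t], the leaf [i] sits at 1, where [c] sends it to 0 as required. The image of [c] avoids
     1, so [h] is left undefined there to stay injective. *)
  pose h : ptrans 'I_n := [ffun v => if v == ord0 then Some ord0 else
                           if v == o1 then None else f (t v)].
  have -> : f = pt_perm t * c n * h.
    apply/ffunP => v; rewrite !pt_mulE ffunE /= cE.
    rewrite tE0 tE1.
    case: eqP => [->|/eqP v0] //=; case: eqP => [->|/eqP vi] /=.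
      by rewrite ffunE fi.
    by rewrite ffunE tE0 tE1 (negPf v0) (negPf vi) tpermK.
  apply: mulN; first apply: mulN.
  - exact: perm_leaf.
  - by apply: genN; rewrite !inE eqxx ?orbT.
  apply: pt_inj_fix0; last by rewrite ffunE.
  have nh v : v != o1 -> f (t v) <> Some ord0.
    move=> v1 ftv; move: v1; rewrite (perm_inj (_ : t v = t o1)) ?eqxx //.
    by rewrite [RHS]tpermL; apply: fI fi.
  move=> u v w; rewrite !ffunE.
  case: (eqVneq u ord0) => [->|_]; case: (eqVneq v ord0) => [->|_] //.
  - by case=> <-; case: (eqVneq v o1) => // v1 /(nh _ v1).
  - by case: (eqVneq u o1) => // u1 fu [w0]; case: (nh _ u1); rewrite w0.
  case: (eqVneq u o1) => // _; case: (eqVneq v o1) => // _ h1 h2.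
  by apply: (@perm_inj _ t); apply: fI h1 h2.
have [j0|j0] := eqVneq j ord0; first by apply: pt_inj_fix0; rewrite // f0 j0.
(* The edge from 0 to [v] goes to an edge at the leaf [j], whose other end is the centre. *)
have fL v w : v != ord0 -> f v = Some w -> w = ord0.
  move=> v0 fv; have := fE _ _ _ _ f0 fv; rewrite !starE eqxx (negPf v0) (negPf j0).
  by move=> /(_ isT); case: (eqVneq w ord0).
(* [g] moves the only possible leaf of the domain to 1, [z1] swaps 0 and 1, and [h] carries 1 to
   [j]; both [g] and [h] fix 0. *)
pose g : ptrans 'I_n := [ffun v => if v == ord0 then Some ord0 else
                         if f v is Some _ then Some o1 else None].
pose h : ptrans 'I_n := [ffun v => if v == ord0 then Some ord0 else
                         if v == o1 then Some j else None].
have -> : f = g * z1 n * h.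
  apply/ffunP => v; rewrite !pt_mulE ffunE.
  case: eqP => [->|/eqP v0]; first by rewrite /= z1E /= ffunE.
  case fv: (f v) => [w|] //=; rewrite z1E /= ffunE.
  by rewrite (fL _ _ v0 fv).
apply: mulN; first apply: mulN.
- apply: pt_inj_fix0; last by rewrite ffunE.
  move=> u v w; rewrite !ffunE.
  case: eqP => [->|/eqP u0]; case: eqP => [->|/eqP v0] //.
  + by case=> <-; case: (f v).
  + by case: (f u) => // _ [<-].
  case fu: (f u) => [u'|] // _; case fv: (f v) => [v'|] // _.
  by apply: (fI _ _ _ fu); rewrite fv (fL _ _ u0 fu) (fL _ _ v0 fv).
- by apply: genN; rewrite !inE eqxx ?orbT.
apply: pt_inj_fix0; last by rewrite ffunE.
move=> u v w; rewrite !ffunE; case: (eqVneq u ord0) => [->|_]; case: (eqVneq v ord0) => [->|_] //.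
- by case=> <-; case: (eqVneq v o1) => // _ [j']; rewrite j' eqxx in j0.
- by case: (eqVneq u o1) => // _ [<-] [j']; rewrite -j' eqxx in j0.
by case: (eqVneq u o1) => // -> _; case: (eqVneq v o1).
Qed.

End Generate.

(** * Membership of the six elements in IEnd(S_n) *)

Lemma gens_sub_IEnd : [set a0 n; b0 n; e1 n; c n; d n; z1 n] \subset I.
Proof.
have permI s : s ord0 = ord0 -> pt_perm s \in I.
  move=> s0; apply/in_IEndP; split=> [u v w|u v u' v']; rewrite !ffunE.
    by case=> <- [/perm_inj].
  have sE a : (s a == ord0) = (a == ord0) by rewrite -{1}s0 (inj_eq perm_inj).
  by case=> <- [<-]; rewrite !starE !sE.
apply/subsetP => f fS.
(* Partial identities; this covers [e1] and [d]. *)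
have fixI (D : pred 'I_n) g :
    (forall v, g v = if D v then None else Some v) -> g \in I.
  move=> gE; apply/in_IEndP; split=> [u v w|u v u' v']; rewrite !gE.
    by case: (D u) => // -[->]; case: (D v) => // -[].
  by case: (D u) => // -[->]; case: (D v) => // -[->].
move: fS; rewrite 5!in_setU !in_set1 -!orbA.
case/or4P=> [/eqP->|/eqP->|/eqP->|/or3P[] /eqP->].
- by rewrite a0_perm permI // tpermD.
- have [s sE sS] := b0_perm; rewrite sE permI //.
  have : b0 n ord0 = Some ord0 by apply/pt_ofP.
  by rewrite sE ffunE => -[].
- exact: fixI e1E.
- apply/in_IEndP; split=> [u v w|u v u' v']; rewrite !cE.
    case: (eqVneq u ord0) => // u0; case: (eqVneq v ord0) => // v0.
    case: (eqVneq u o1) => [->|u1]; case: (eqVneq v o1) => [->|v1] //.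
    + by move=> [<-] [/eqP]; rewrite (negPf v0).
    + by move=> [<-] [/esym/eqP]; rewrite (negPf u0).
    by move=> [->] [->].
  by rewrite starE; case: (eqVneq u ord0) => // u0; case: (eqVneq v ord0).
- exact: fixI dE.
apply/in_IEndP; split=> [u v w|u v u' v']; rewrite !z1E.
  case: (eqVneq u ord0) => [->|u0]; case: (eqVneq v ord0) => [->|v0] //.
  - by case: (eqVneq v o1) => // _ [<-].
  - by case: (eqVneq u o1) => // _ [<-].
  by case: (eqVneq u o1) => // ->; case: (eqVneq v o1).
rewrite !starE.
case: (eqVneq u ord0) => [_|u0]; case: (eqVneq v ord0) => [_|v0] //.
  by case: (eqVneq v o1) => // _ [<-] [<-].
by case: (eqVneq u o1) => // _ [<-] [<-].
Qed.

(** * Domain and image invariants of members of IEnd(S_n) *)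

Definition total f : bool := [forall v, f v].
Definition leafdom f : bool := [forall v, (v != ord0) ==> f v].
Definition hits0 f : bool := [exists v, f v == Some ord0].
Definition leaf_hits0 f : bool := [exists v, (v != ord0) && (f v == Some ord0)].
Definition misses_one f : bool :=
  [exists i, (f i == None) && [forall v, (v != i) ==> f v]].

(** The leaves 1, 2, 3 exist, and [i] excludes at most one of them. *)
Lemma two_leaves (i : 'I_n) :
  exists u v, [/\ u != v, u != ord0, v != ord0, u != i & v != i].
Proof.
have [->|i1] := eqVneq i o1; first by exists o2, o3.
have [->|i2] := eqVneq i o2; first by exists o1, o3.
by exists o1, o2; rewrite ![_ == i]eq_sym.
Qed.

(** If 0 went to a leaf, both leaves [u] and [v] would have to go to 0, against injectivity. *)
Lemma IEnd_fix0 f (u v w : 'I_n) :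
  f \in I -> f ord0 = Some w -> u != v -> u != ord0 -> v != ord0 -> f u -> f v ->
  w = ord0.
Proof.
move=> /in_IEndP[fI fE] f0 uv u0 v0.
case fu: (f u) => [u'|] // _; case fv: (f v) => [v'|] // _.
have [//|w0] := eqVneq w ord0; case/eqP: uv; apply: (fI _ _ _ fu); rewrite fv.
have := fE _ _ _ _ f0 fu; have := fE _ _ _ _ f0 fv.
rewrite !starE eqxx (negPf u0) (negPf v0) (negPf w0).
by case: (eqVneq v' ord0) => [->|_ /(_ isT)//]; case: (eqVneq u' ord0) => [->|_ _ /(_ isT)].
Qed.

Lemma total_perm f :
  f \in I -> total f -> exists2 s, f = pt_perm s & s ord0 = ord0.
Proof.
move=> fI /forallP fT; have /in_IEndP[finj _] := fI.
have [s sE] := pt_inj_total finj fT; exists s => //.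
by apply: (@IEnd_fix0 f o1 o2); rewrite // sE ffunE.
Qed.

(** A total [f] is a permutation, so every point is a value of [f] and [g] must be defined there. *)
Lemma totalM f g : f \in I -> total (f * g) -> total f && total g.
Proof.
move=> fI /forallP T; have fT : total f.
  by apply/forallP => v; have := T v; rewrite pt_mulE; case: (f v).
rewrite fT; have [s sE _] := total_perm fI fT; apply/forallP => v.
by have := T (s^-1 v); rewrite pt_mulE sE ffunE /= permKV.
Qed.

Lemma leafdomMl f g : leafdom (f * g) -> leafdom f.
Proof.
move=> /forall_inP L; apply/forall_inP => v /L; rewrite pt_mulE.
by case: (f v).
Qed.

(** Such an [f] injects the leaves into the leaves, hence permutes them; setting 0 to 0 turns it
    into a permutation of all points. *)
Lemma leaf_onto f (w : 'I_n) :
    f \in I -> leafdom f -> ~~ leaf_hits0 f -> w != ord0 ->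
  exists2 v, v != ord0 & f v = Some w.
Proof.
move=> /in_IEndP[fI _] /forall_inP L; rewrite negb_exists_in => /forall_inP H w0.
pose g : ptrans 'I_n := [ffun v => if v == ord0 then Some ord0 else f v].
have [|v|s sE] := @pt_inj_total _ g.
- move=> u v x; rewrite !ffunE.
  case: (eqVneq u ord0) => [->|u0]; case: (eqVneq v ord0) => [->|v0] //.
  + by case=> <- fv; have := H v v0; rewrite fv eqxx.
  + by move=> fu [x0]; have := H u u0; rewrite fu x0 eqxx.
  exact: fI.
- by rewrite ffunE; case: (eqVneq v ord0) => // /L.
have : g (s^-1 w) = Some w by rewrite sE ffunE permKV.
rewrite ffunE; case: eqVneq => [_ [w0']|v0 fv]; first by rewrite w0' eqxx in w0.
by exists (s^-1 w).
Qed.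

(** * Classes met by every generating set, and the lower bound 6 *)

Section Rank.

Variable A : {set ptrans 'I_n}.
Hypothesis genA : mgen A = I.

Lemma gen_IEnd f : f \in A -> f \in I.
Proof. by rewrite -genA; apply/subsetP/sub_mgen. Qed.

Lemma gen_escape (P : pred (ptrans 'I_n)) f :
    f \in I -> ~~ P f -> P 1 ->
    {in I &, forall u v, P u -> P v -> P (u * v)} ->
  exists2 a, a \in A & ~~ P a.
Proof. by rewrite -genA; apply: mgen_escape. Qed.

Let gensI f : f \in [set a0 n; b0 n; e1 n; c n; d n; z1 n] -> f \in I.
Proof. exact: (subsetP gens_sub_IEnd). Qed.

(** With at most one total generator, any two units would commute, but [a0] and [b0] do not. *)
Lemma gen_two_units :
  exists u v, [/\ u \in A, v \in A, total u, total v & u != v].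
Proof.
suff /card_gt1P[u [v []]] : 1 < #|[set f in A | total f]|.
  by rewrite !inE => /andP[uA uT] /andP[vA vT] uv; exists u, v.
rewrite ltnNge; apply/negP => le1.
have a0T : total (a0 n) by apply/forallP => v; rewrite a0_perm ffunE.
have [s sE sS] := b0_perm.
have b0T : total (b0 n) by apply/forallP => v; rewrite sE ffunE.
(* Commuting with [g] spreads from total generators to all units, since a total product has total
   factors. *)
have comm (g : ptrans 'I_n) :
    (forall f, f \in A -> total f -> f * g = g * f) ->
    forall f, f \in I -> total f -> f * g = g * f.
  move=> Ag f fI fT; apply/eqP; apply: contraT => fg.
  have [||||a aA] := @gen_escape (fun x => total x ==> (x * g == g * x)) f.
  - exact: fI.
  - by rewrite fT.
  - by rewrite mul1g mulg1 eqxx implybT.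
  - move=> u v uI vI /implyP Pu /implyP Pv; apply/implyP => uvT.
    have /andP[/Pu/eqP ug /Pv/eqP vg] := totalM uI uvT.
    by rewrite -mulgA vg !mulgA ug.
  by rewrite negb_imply => /andP[aT]; rewrite (Ag _ aA aT) eqxx.
(* The sole total generator [f] commutes with itself, hence with the unit [a0]; a second use of
   [comm], now for [a0], then reaches [b0]. *)
have cAa f : f \in A -> total f -> f * a0 n = a0 n * f.
  move=> fA fT; apply/esym/comm => //; last by apply: gensI; rewrite !inE eqxx.
  move=> g gA gT; suff -> : g = f by [].
  have fin : f \in [set f in A | total f] by rewrite inE fA.
  have := card_le1P le1 _ fin g; rewrite !inE gA gT /= => /esym/eqP //.
have := comm _ cAa (b0 n); rewrite b0T gensI; last by rewrite !inE eqxx ?orbT.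
(* At the leaf 1, [b0 * a0] gives 1 while [a0 * b0] gives 3. *)
move=> /(_ isT isT) /ffunP/(_ o1); rewrite !pt_mulE sE a0_perm !ffunE /= !ffunE.
by rewrite tpermL (sS o1 o2) // (sS o2 o3) // tpermR.
Qed.

(** If a product fixes 0 and is undefined at exactly one point, then so is its first factor, or else
    that factor is a permutation fixing 0 and the second factor has this property. [e1] has it. *)
Lemma gen_misses_one : exists f, [/\ f \in A, f ord0 = Some ord0 & ~~ total f].
Proof.
have [||||f fA] :=
  @gen_escape (fun f => ~~ ((f ord0 == Some ord0) && misses_one f)) (e1 n).
- by apply: gensI; rewrite !inE eqxx ?orbT.
- rewrite negbK e1E /=; apply/existsP; exists ord_max; rewrite e1E eqxx /=.
  by apply/forall_inP => v; rewrite e1E => /negPf->.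
- rewrite negb_and; apply/orP; right; apply/existsPn => i.
  by rewrite ffunE.
- move=> x y xI yI Px Py; apply/negP => /andP[/eqP xy0 /existsP[i /andP[/eqP xyi]]].
  move=> /forall_inP xyT.
  have xT v : v != i -> x v by move=> /xyT; rewrite pt_mulE; case: (x v).
  (* Two leaves in the domain of [x] force [x] to fix 0. *)
  have [u [v [uv u0 v0 ui vi]]] := two_leaves i.
  have x0 : x ord0 = Some ord0.
    case x0: (x ord0) => [w|]; last by move: xy0; rewrite pt_mulE x0.
    by rewrite (IEnd_fix0 xI x0 uv) // xT.
  case/negP: Px; rewrite x0 eqxx; apply/existsP; exists i.
  apply/andP; split; last exact/forall_inP.
  apply/eqP; case xi: (x i) => [j|] //; exfalso.
  have xtot : total x.
    by apply/forallP => w; have [->|/xT//] := eqVneq w i; rewrite xi.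
  have [s sE s0] := total_perm xI xtot.
  case/negP: Py; apply/andP; split; first by move: xy0; rewrite pt_mulE x0 /= => ->.
  apply/existsP; exists (s i); apply/andP; split.
    by move: xyi; rewrite pt_mulE sE ffunE /= => ->.
  apply/forall_inP => w ws; have := xyT (s^-1 w).
  rewrite pt_mulE sE ffunE /= permKV; apply.
  by apply: contraNneq ws => <-; rewrite permKV.
rewrite negbK => /andP[/eqP f0 /existsP[i /andP[/eqP fi _]]].
by exists f; split=> //; apply/forallPn; exists i; rewrite fi.
Qed.

Lemma gen_moves0 : exists f w, [/\ f \in A, f ord0 = Some w & w != ord0].
Proof.
have [||||f fA] :=
  @gen_escape (fun f => if f ord0 is Some w then w == ord0 else true) (z1 n).
- by apply: gensI; rewrite !inE eqxx ?orbT.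
- by rewrite z1E.
- by rewrite ffunE.
- move=> x y _ _; rewrite pt_mulE.
  by case: (x ord0) => [w|] //= /eqP->.
by case f0: (f ord0) => [w|] // w0; exists f, w.
Qed.

(** [c] is defined on all leaves and sends one to 0. If neither factor does so, neither does the
    product: the first factor would permute the leaves, so the second would be defined on all of
    them. *)
Lemma gen_hits0 : exists f, [/\ f \in A, f ord0 = None & hits0 f].
Proof.
have [||||f fA] := @gen_escape (fun f => leafdom f ==> ~~ leaf_hits0 f) (c n).
- by apply: gensI; rewrite !inE eqxx ?orbT.
- rewrite negb_imply negbK; apply/andP; split.
    by apply/forall_inP => v v0; rewrite cE (negPf v0); case: eqP.
  by apply/existsP; exists o1; rewrite cE.
- apply/implyP => _; apply/exists_inPn => v v0; rewrite ffunE.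
  by apply: contra v0 => /eqP[->].
- move=> x y xI yI /implyP Px /implyP Py; apply/implyP => xyL.
  have xL := leafdomMl xyL; have xN := Px xL.
  have yL : leafdom y.
    apply/forall_inP => w w0; have [v v0 xv] := leaf_onto xI xL xN w0.
    by have /forall_inP/(_ v v0) := xyL; rewrite pt_mulE xv.
  have yN := Py yL; apply/exists_inPn => v v0; rewrite pt_mulE.
  case xv: (x v) => [w|] //=.
  have w0 : w != ord0.
    by apply: contraNneq xN => w0; apply/exists_inP; exists v; rewrite // xv w0.
  by move/exists_inPn: yN => /(_ w w0).
rewrite negb_imply negbK => /andP[/forall_inP L /exists_inP[v v0 /eqP fv]].
exists f; split=> //; last by apply/existsP; exists v; rewrite fv.
(* Were [f] defined at 0 it would fix 0, colliding with the leaf [v] sent to 0. *)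
case f0: (f ord0) => [w|] //; have fI := gen_IEnd fA.
have w0 : w = ord0 by apply: (@IEnd_fix0 f o1 o2); rewrite // L.
have /in_IEndP[inj _] := fI; case/eqP: v0.
by apply: inj fv _; rewrite f0 w0.
Qed.

(** [d] has the leaves as its domain and misses 0. The maps that hit 0 whenever their domain is the
    set of leaves are closed under product. *)
Lemma gen_avoids0 : exists f, [/\ f \in A, f ord0 = None & ~~ hits0 f].
Proof.
have [||||f fA] :=
  @gen_escape (fun f => leafdom f && (f ord0 == None) ==> hits0 f) (d n).
- by apply: gensI; rewrite !inE eqxx ?orbT.
- rewrite negb_imply dE eqxx andbT; apply/andP; split.
    by apply/forall_inP => v v0; rewrite dE (negPf v0).
  by apply/existsPn => v; rewrite dE; case: (eqVneq v ord0).
- by rewrite ffunE andbF.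
- move=> x y xI yI /implyP Px /implyP Py; apply/implyP => /andP[xyL /eqP xy0].
  have xL := leafdomMl xyL.
  have xyT v : v != ord0 -> exists2 w, x v = Some w & y w.
    move=> v0; have /forall_inP/(_ v v0) := xyL; rewrite pt_mulE.
    by case: (x v) => // w yw; exists w.
  have /in_IEndP[xinj _] := xI.
  (* If [x] is defined at 0, it is a permutation fixing 0, and [y] inherits the domain of all
     leaves. *)
  case x0: (x ord0) => [w|].
    have w0 : w = ord0.
      by apply: (@IEnd_fix0 x o1 o2 w xI x0); rewrite //; apply: (forall_inP xL).
    have xT : total x.
      apply/forallP => v; have [->|v0] := eqVneq v ord0; first by rewrite x0.
      exact: (forall_inP xL).
    have [s sE s0] := total_perm xI xT.
    have y0 : y ord0 = None by move: xy0; rewrite pt_mulE x0 w0.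
    have /existsP[v /eqP yv] : hits0 y.
      apply: Py; rewrite y0 andbT; apply/forall_inP => v v0.
      have sv0 : s^-1 v != ord0.
        by apply: contraNneq v0 => sv; rewrite -(permKV s v) sv s0.
      by have [u] := xyT _ sv0; rewrite sE ffunE permKV => -[<-].
    by apply/existsP; exists (s^-1 v); rewrite pt_mulE sE ffunE /= permKV yv.
  have /existsP[v /eqP xv] : hits0 x by apply: Px; rewrite xL x0.
  (* Here [x] sends [v] to 0, so [y] is defined at 0; the images of two further leaves are leaves in
     the domain of [y], forcing [y] to fix 0. *)
  have [u [t [ut u0 t0 uv tv]]] := two_leaves v.
  have v0 : v != ord0 by apply: contraPneq xv => ->; rewrite x0.
  have [w xv' yw] := xyT _ v0; move: xv'; rewrite xv => -[w0].
  have [u' xu yu] := xyT _ u0; have [t' xt yt] := xyT _ t0.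
  apply/existsP; exists v; rewrite pt_mulE xv /=.
  case y0: (y ord0) yw => [z|]; last by rewrite -w0 y0.
  move=> _; rewrite (@IEnd_fix0 y u' t' z yI y0) //.
  + by apply: contraNneq ut => ut'; apply/eqP; apply: xinj xu _; rewrite xt ut'.
  + by apply: contraNneq uv => u'0; apply/eqP; apply: xinj xu _; rewrite xv u'0.
  by apply: contraNneq tv => t'0; apply/eqP; apply: xinj xt _; rewrite xv t'0.
rewrite negb_imply => /andP[/andP[_ /eqP f0] fN].
by exists f.
Qed.

Lemma gen_card : 6 <= #|A|.
Proof.
have [u [v [uA vA uT vT uv]]] := gen_two_units.
have [e [eA e0 eT]] := gen_misses_one.
have [z [w [zA z0 w0]]] := gen_moves0.
have [h [hA h0 hH]] := gen_hits0.
have [k [kA k0 kH]] := gen_avoids0.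
(* [kind] separates the five classes; only [u] and [v] share one, and they are distinct by
   choice. *)
pose kind f := if f ord0 is Some w then
    if w != ord0 then 0%N else if total f then 1%N else 2
  else if hits0 f then 3 else 4.
have totk f : f \in A -> total f -> kind f = 1%N.
  move=> /gen_IEnd fI fT; have [s sE s0] := total_perm fI fT.
  by rewrite /kind fT {1}sE ffunE s0.
have ku := totk u uA uT; have kv := totk v vA vT.
have ke : kind e = 2 by rewrite /kind e0 (negPf eT).
have kz : kind z = 0%N by rewrite /kind z0 w0.
have kh : kind h = 3 by rewrite /kind h0 hH.
have kk : kind k = 4 by rewrite /kind k0 (negPf kH).
have neq f g : kind f != kind g -> f != g by apply: contraNneq => ->.
have /card_uniqP/= <- : uniq [:: u; v; e; z; h; k].
  by rewrite /= !inE !negb_or uv !neq // ?ku ?kv ?ke ?kz ?kh ?kk.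
apply: subset_leq_card; apply/subsetP => f.
by rewrite !inE => /or4P[/eqP->|/eqP->|/eqP->|/or3P[] /eqP->].
Qed.

End Rank.

End Star.

Local Close Scope group_scope.

Theorem theorem3p10 (n : nat) (hn : 4 <= n) :
  IEnd (@star n) = mgen [set a0 n; b0 n; e1 n; c n; d n; z1 n] /\
  mrank (IEnd (@star n)) = 6.
Proof.
case: n hn => [|[|[|[|m]]]] // _; set S := [set _; _; _; _; _; _].
have IE : IEnd (@star m.+4) = mgen S.
  apply/eqP; rewrite eqEsubset; apply/andP; split.
    by apply: IEnd_sub_gen; [apply: mgen_monoid|apply: sub_mgen].
  apply: mgen_min (gens_sub_IEnd m); exact/monoid_setP/IEnd_monoid.
split=> //; have [[A genA <-] min] := mrankP (IEnd_monoid (@star m.+4)).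
apply/eqP; rewrite eqn_leq gen_card // andbT.
apply: leq_trans (min S _) _; first by rewrite IE.
(* The length of this list bounds [#|S|] by 6. *)
pose s := [:: a0 m.+4; b0 m.+4; e1 m.+4; c m.+4; d m.+4; z1 m.+4].
apply: leq_trans (card_size s); apply: subset_leq_card; apply/subsetP => f.
by rewrite !inE -!orbA.
Qed.
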